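(* Let $X$ be a compact metric space and let $F$ be a finite subset of $X\times X$. Then the following are equivalent: (1) $F$ is CR-turbulent. (2) There is some $n\in\mathbb{N}$ such that $(\sigma_F^+)^n$ is separated turbulent. (3) There are some $n\in\mathbb{N}$ and two points $\mathbf{x},\mathbf{y}\in X_F^n$ such that $\mathbf{x}\ne\mathbf{y}$ and $\pi_1(\mathbf{x})=\pi_1(\mathbf{y})=\pi_{n+1}(\mathbf{x})=\pi_{n+1}(\mathbf{y})$. (4) $ent(\sigma_F^+)\neq 0$. (5) $X_F^+$ is uncountable. (6) $(X_F^+,\sigma_F^+)$ is Li–Yorke chaotic. (7) $(X_F^+,\sigma_F^+)$ has a DC2-scrambled Cantor set.
   Context: $\mathbb{N}$ denotes the positive integers. For a closed relation $F\subset X\times X$ and $m\in\mathbb{N}$, $X_F^m=\{(x_1,\dots,x_{m+1})\in X^{m+1}: (x_i,x_{i+1})\in F \text{ for } 1\le i\le m\}$, and $X_F^+=\{(x_1,x_2,\dots)\in\prod_{i=1}^\infty X: (x_i,x_{i+1})\in F \text{ for all } i\in\mathbb{N}\}$ (product topology, any compatible metric $d$). The shift map is $\sigma_F^+:X_F^+\to X_F^+$, $\sigma_F^+(x_1,x_2,\dots)=(x_2,x_3,\dots)$. $\pi_i$ is the projection to the $i$-th coordinate. $F$ is CR-turbulent if there are $n\in\mathbb{N}$ and two disjoint nonempty closed sets $K,L\subset X_F^n$ such that $\pi_1(K)\cup\pi_1(L)\subset\pi_{n+1}(K)\cap\pi_{n+1}(L)$ (here $\pi_{n+1}$ is the last coordinate).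 A continuous self-map $f$ of a compact metric space $Z$ is separated turbulent if there are disjoint nonempty closed sets $K,L\subset Z$ with $K\cup L\subset f(K)\cap f(L)$. $ent(f)$ is the topological entropy: $ent(f)=\sup_\alpha \lim_{m\to\infty}\frac{1}{m}\log N(\vee_{i=0}^m f^{-i}(\alpha))$, where $\alpha$ ranges over open covers, $\vee$ denotes the common refinement, and $N(\beta)$ is the minimal cardinality of a subcover of $\beta$ (entropy is taken to be $0$ if the space is empty). $(Z,f)$ is Li–Yorke chaotic if there is an uncountable set $S\subset Z$ such that for all distinct $x,y\in S$: $\liminf_{n}d(f^n(x),f^n(y))=0$ and $\limsup_n d(f^n(x),f^n(y))>0$. A DC2-scrambled Cantor set for $(Z,f)$ is a set $C\subset Z$ homeomorphic to the Cantor set such that every pair of distinct $x,y\in C$ is DC2-scrambled, i.e. $\liminf_{n}\frac1n\sum_{i=0}^{n-1}d(f^i(x),f^i(y))=0$ and $\limsup_{n}\frac1n\sum_{i=0}^{n-1}d(f^i(x),f^i(y))>0$. *)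

(* Defs.v *)
From mathcomp Require Import all_boot all_order all_algebra.
From mathcomp Require Import all_classical all_reals all_analysis.

Set Implicit Arguments.
Unset Strict Implicit.
Unset Printing Implicit Defensive.

Import Order.TTheory GRing.Theory Num.Theory.
Import numFieldNormedType.Exports.

Local Open Scope classical_set_scope.
Local Open Scope card_scope.
Local Open Scope ring_scope.

(* Subspaces are types [set_type A] carrying the topology induced by the
   inclusion.  Products are written with [prod_topology] so that they carry
   the product topology, independently of any instance on function types.
   Coordinates are numbered from 0: coordinate [i] here is the (i+1)-st one. *)

Definition finite_paths (R : realType) (X : metricType R) (F : set (X * X))
    (m : nat) : set (prod_topology (fun _ : 'I_m.+1 => X)) :=
  [set x | forall i : 'I_m, F (x (widen_ord (leqnSn m) i), x (lift ord0 i))].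
Arguments finite_paths {R X} F m _.

Definition infinite_paths (R : realType) (X : metricType R) (F : set (X * X)) :
    set (prod_topology (fun _ : nat => X)) :=
  [set x | forall i, F (x i, x i.+1)].
Arguments infinite_paths {R X} F _.

Section Paths.
Context {R : realType} {X : metricType R}.
Implicit Type F : set (X * X).

Definition path_coord F (m : nat) (i : 'I_m.+1) (x : set_type (finite_paths F m)) : X :=
  set_val x i.

Lemma shift_infinite_paths F (x : set_type (infinite_paths F)) :
  (fun i => set_val x i.+1) \in infinite_paths F.
Proof. by apply/mem_set => i; exact: (set_mem (valP x)). Qed.

Definition shift_map F (x : set_type (infinite_paths F)) :
  set_type (infinite_paths F) :=
  exist (fun z => z \in infinite_paths F) _ (shift_infinite_paths x).

Definition CR_turbulent F : Prop :=
  exists2 n : nat, (0 < n)%N &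
  exists K L : set (set_type (finite_paths F n)),
    [/\ closed K /\ closed L, K !=set0 /\ L !=set0, K `&` L = set0 &
        path_coord ord0 @` K `|` path_coord ord0 @` L
          `<=` (path_coord ord_max @` K) `&` (path_coord ord_max @` L)].

End Paths.

Section Dynamics.
Context {Z : topologicalType}.
Implicit Type f : Z -> Z.

Definition separated_turbulent f : Prop :=
  exists K L : set Z,
    [/\ closed K /\ closed L, K !=set0 /\ L !=set0, K `&` L = set0 &
        K `|` L `<=` (f @` K) `&` (f @` L)].

Definition open_cover (alpha : set (set Z)) : Prop :=
  (forall A, alpha A -> open A) /\ \bigcup_(A in alpha) A = setT.

(* The common refinement of the covers f^{-i}(alpha), 0 <= i <= m. *)
Definition iterated_join f (alpha : set (set Z)) (m : nat) : set (set Z) :=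
  [set B | exists2 A : nat -> set Z,
     (forall i, (i <= m)%N -> alpha (A i)) &
     B = \bigcap_(i in [set i | (i <= m)%N]) (iter i f @^-1` A i)].

Definition subcover_card (beta : set (set Z)) (n : nat) : Prop :=
  exists2 gamma : set (set Z), gamma `<=` beta &
    \bigcup_(A in gamma) A = setT /\ gamma #= `I_n.

(* Minimal cardinality of a subcover; the infimum is attained as soon as
   beta has a finite subcover. *)
Definition min_subcover (R : realType) (beta : set (set Z)) : R :=
  inf [set n%:R | n in subcover_card beta].

(* The value of the sequence at m = 0 does not affect the limit. *)
Definition cover_entropy (R : realType) f (alpha : set (set Z)) : \bar R :=
  limn (fun m : nat =>
    (ln (min_subcover R (iterated_join f alpha m)) / m%:R)%:E).

Definition entropy (R : realType) f : \bar R :=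
  if `[< [set: Z] = set0 >] then 0%E
  else ereal_sup [set cover_entropy R f alpha | alpha in open_cover].

End Dynamics.

(* [d] is a metric on [Z] inducing its topology. *)
Definition compatible_metric (R : realType) (Z : topologicalType)
    (d : Z -> Z -> R) : Prop :=
  [/\ forall x y, d x y = 0 <-> x = y,
      forall x y, d x y = d y x,
      forall x y z, d x z <= d x y + d y z &
      forall (x : Z) (A : set Z),
        nbhs x A <-> exists2 e : R, 0 < e & [set y | d x y < e] `<=` A].

Section Scrambled.
Context {R : realType} {Z : topologicalType}.
Variables (d : Z -> Z -> R) (f : Z -> Z).

Definition orbit_dist (x y : Z) (n : nat) : R := d (iter n f x) (iter n f y).

(* The value at n = 0 is 0 and does not affect lower and upper limits. *)
Definition mean_orbit_dist (x y : Z) (n : nat) : R :=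
  n%:R^-1 * \sum_(i < n) orbit_dist x y i.

Definition LY_scrambled (x y : Z) : Prop :=
  limn_einf (fun n => (orbit_dist x y n)%:E) = 0%E /\
  (0 < limn_esup (fun n => (orbit_dist x y n)%:E))%E.

Definition DC2_scrambled (x y : Z) : Prop :=
  limn_einf (fun n => (mean_orbit_dist x y n)%:E) = 0%E /\
  (0 < limn_esup (fun n => (mean_orbit_dist x y n)%:E))%E.

Definition Li_Yorke_chaotic : Prop :=
  exists2 S : set Z, ~ countable S &
    forall x y, S x -> S y -> x <> y -> LY_scrambled x y.

Definition homeomorphic (A B : topologicalType) : Prop :=
  exists (h : A -> B) (g : B -> A),
    [/\ continuous h, continuous g, cancel h g & cancel g h].

Definition has_DC2_scrambled_Cantor_set : Prop :=
  exists2 C : set Z, homeomorphic cantor_space (set_type C) &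
    forall x y, C x -> C y -> x <> y -> DC2_scrambled x y.

End Scrambled.

(* Main.v *)
Require Import Defs.
From mathcomp Require Import all_boot all_order all_algebra.
From mathcomp Require Import all_classical all_reals all_analysis.
From mathcomp Require Import zify lra.

Import Order.TTheory GRing.Theory Num.Theory.
Import numFieldNormedType.Exports.

Set Implicit Arguments.
Unset Strict Implicit.
Unset Printing Implicit Defensive.

Local Open Scope classical_set_scope.

(** A finite relation is a finite directed graph and the points of the path
    space are its infinite walks.  Every condition of the theorem is compared
    with a single combinatorial one, [has_double_loop]: some vertex carries two
    different closed walks of the same length [n].

    If there is a double loop [(p, q)], then any binary sequence can be coded
    by a concatenation of copies of [p] and [q].  This map, [coding], embeds the
    Cantor space continuously and carries the shift of binary sequences to the
    [n]-th power of the shift of paths.  The images of the two sets of sequences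
    with a given first bit show that this power is separated turbulent, and the
    [2 ^ k] words made of [k] blocks bound the entropy below by [ln 2 / n].  For
    scrambling one codes not a sequence [c] itself but a sequence [spread c]
    that is constant on intervals [[a, a * a)]: infinitely many of them carry
    the bit [false], and each bit of [c] is also carried by infinitely many.
    Such an interval is so long compared with what precedes it that the average
    at its end is decided by the interval alone; hence two points with different
    [c] are close on average at some times and far apart on average at others
    ([scrambled_point_LY], [scrambled_point_DC2]).

    If there is no double loop, then a walk that leaves a vertex and returns to
    it at a given time is determined by that time ([unique_return]).  This has
    two consequences.
    - A finite walk is determined by the first and the last visit to each
      vertex ([visit_code_inj]), so the number of walks of length [m] is
      polynomial in [m].  This excludes positive entropy, because subadditivity
      would turn it into exponential growth ([cover_entropy_fin]).  It also
      excludes both forms of turbulence, which provide two distinguishable ways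
      of prolonging walks backwards, hence [2 ^ k] walks after [k] steps
      ([branching_double_loop]).
    - An infinite walk is determined by any initial segment that ends at a
      vertex visited infinitely often, so there are only countably many infinite
      walks ([countable_walks]), whereas both kinds of chaos need uncountably
      many.

    The bridge between topology and combinatorics is that points of the path
    space with a long common initial segment are uniformly close: every
    neighborhood contains a cylinder, cylinders are open because the graph is
    finite, and by compactness the length of the cylinders can be chosen
    uniformly ([cylinder_refines]). *)

(** * Walks in a graph without double loops *)

Section Walks.
Context {X : choiceType}.
Implicit Types (F : set (X * X)) (w p q : nat -> X).

Definition walk F m w := forall i, i < m -> F (w i, w i.+1).

Definition agree m w w' := forall i, i < m -> w i = w' i.

Definition double_loop F n p q :=
  [/\ 0 < n, walk F n p /\ walk F n q, p 0 = q 0, p 0 = p n /\ q 0 = q n &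
      ~ agree n.+1 p q].

Definition has_double_loop F := exists n p q, double_loop F n p q.

(** Otherwise the two pieces between the times [a] and [b] would form a double
    loop. *)
Lemma unique_return F m w w' a b : ~ has_double_loop F ->
  walk F m w -> walk F m w' -> b <= m ->
  w a = w b -> w' a = w' b -> w a = w' a ->
  forall t, a <= t <= b -> w t = w' t.
Proof.
move=> nF Fw Fw' bm wab w'ab ww' t /andP[at_ tb].
have [ab|ba] := ltnP a b; last by have -> : t = a by lia.
apply: contrapT => wt; apply: nF.
exists (b - a), (fun i => w (a + i)), (fun i => w' (a + i)); split.
- by rewrite subn_gt0.
- by split=> i ib; rewrite addnS; [apply: Fw|apply: Fw']; lia.
- by rewrite addn0.
- by rewrite addn0 subnKC// ltnW.
- by move/(_ (t - a)); rewrite subnKC// => H; apply/wt/H; lia.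
Qed.

(** The value is [m.+1] if [v] is not visited up to time [m]. *)
Definition first_hit m w v := find (fun i => w i == v) (iota 0 m.+1).

Lemma first_hit_leq m w i : i <= m -> first_hit m w (w i) <= i.
Proof.
move=> im; rewrite leqNgt; apply/negP => /(before_find 0).
by rewrite nth_iota ?ltnS// eqxx.
Qed.

Lemma first_hit_eq m w v : first_hit m w v <= m -> w (first_hit m w v) = v.
Proof.
rewrite -ltnS -[X in _ < X](size_iota 0 m.+1) -has_find => hasv.
have := nth_find 0 hasv; rewrite nth_iota; first by move/eqP.
by rewrite -[X in _ < X](size_iota 0 m.+1) -has_find.
Qed.

Lemma first_hit_lt m w v : first_hit m w v < m.+2.
Proof. by rewrite ltnS -[X in _ <= X](size_iota 0 m.+1) find_size. Qed.

(** The first visit of the walk run backwards; the value for a vertex that is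
    not visited is junk, which is harmless because [first_hit] detects this
    case. *)
Definition last_hit m w v := m - first_hit m (fun i => w (m - i)) v.

Lemma last_hitP m w i : i <= m ->
  i <= last_hit m w (w i) <= m /\ w (last_hit m w (w i)) = w i.
Proof.
move=> im; rewrite /last_hit; set w' := fun i => w (m - i).
have -> : w i = w' (m - i) by rewrite /w' subKn.
have H := @first_hit_leq m w' (m - i) (leq_subr _ _).
split; first by lia.
by rewrite -{2}(@first_hit_eq m w' (w' (m - i))) //; lia.
Qed.

Lemma last_hit_lt m w v : last_hit m w v < m.+2.
Proof. by rewrite /last_hit; lia. Qed.

Definition visit_code (vs : seq X) m w : {ffun 'I_(size vs) -> 'I_m.+2 * 'I_m.+2} :=
  [ffun k => let v := tnth (in_tuple vs) k in
     (Ordinal (first_hit_lt m w v), Ordinal (last_hit_lt m w v))].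

(** At time [t] the first walk is at [v := w t], between its first and its last
    visit to [v].  The second walk visits [v] first and last at the same times,
    so both walks perform a return to [v] over the same time interval. *)
Lemma visit_code_inj F (vs : seq X) m w w' : ~ has_double_loop F ->
  walk F m w -> walk F m w' -> (forall i, i <= m -> w i \in vs) ->
  visit_code vs m w = visit_code vs m w' ->
  agree m.+1 w w'.
Proof.
move=> nF Fw Fw' wvs cww' t; rewrite ltnS => tm.
have [k wtk] : exists k, w t = tnth (in_tuple vs) k.
  have := wvs _ tm; rewrite -index_mem => H; exists (Ordinal H).
  by rewrite (tnth_nth (w t)) /= nth_index// wvs.
move/ffunP: cww' => /(_ k); rewrite !ffunE -wtk => -[eq1 eq2].
have f1 := first_hit_leq w tm.
have f2 := first_hit_eq (leq_trans f1 tm).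
have f3 : w' (first_hit m w (w t)) = w t.
  by rewrite eq1 first_hit_eq // -eq1 (leq_trans f1).
have [l1 l2] := last_hitP w tm.
have [l3 l4] := last_hitP w' (leq_trans f1 tm).
rewrite f3 -eq2 in l3 l4.
apply: (unique_return nF Fw Fw' (m := m) (a := first_hit m w (w t))
  (b := last_hit m w (w t))); rewrite ?f2 ?f3 ?l2 ?l4//; lia.
Qed.

Lemma card_visit_code (vs : seq X) m :
  #|{ffun 'I_(size vs) -> 'I_m.+2 * 'I_m.+2}| = ((m.+2 * m.+2) ^ size vs)%N.
Proof. by rewrite card_ffun card_prod !card_ord. Qed.

End Walks.

Lemma poly_lt_exp A B c :
  exists k, (((A * k + B).+2 * (A * k + B).+2) ^ c < 2 ^ k)%N.
Proof.
(* For [k = 2 ^ (2 * i)] the left hand side is at most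
   [2 ^ (2 * (D + 2 * i) * c)], whose exponent is linear in [i]. *)
pose D := (A + B.+2)%N; pose i := (D + 6 * c)%N.
exists (2 ^ (2 * i))%N; set k := (2 ^ (2 * i))%N.
have k0 : 0 < k by rewrite expn_gt0.
have D1 : (A * k + B).+2 <= D * k by rewrite /D; nia.
have D2 : D * k <= 2 ^ (D + 2 * i).
  by rewrite expnD leq_mul2r; apply/orP; right; rewrite ltnW// ltn_expl.
have D3 : (A * k + B).+2 <= 2 ^ (D + 2 * i) := leq_trans D1 D2.
apply: (@leq_ltn_trans ((2 ^ (D + 2 * i) * 2 ^ (D + 2 * i)) ^ c)).
  by have [->//|c0] := posnP c; rewrite leq_exp2r// leq_mul.
rewrite -expnD -expnM ltn_exp2l//.
have H : i < 2 ^ i by rewrite ltn_expl.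
have : k = 2 ^ i * 2 ^ i by rewrite -expnD /k; congr (_ ^ _); lia.
move=> ->; apply: (@leq_trans (i.+1 * i.+1)); last by rewrite leq_mul.
by rewrite /i; nia.
Qed.

(** * Exponential growth produces double loops *)

Section Growth.
Context {X : choiceType}.
Implicit Types (F : set (X * X)) (w p q : nat -> X).

Lemma finite_vertices F : finite_set F ->
  exists vs : seq X, forall x y, F (x, y) -> x \in vs /\ y \in vs.
Proof.
move=> /finite_seqP[es Fes]; exists (map fst es ++ map snd es) => x y.
rewrite Fes /= => xy; rewrite !mem_cat; split.
  by apply/orP; left; apply/mapP; exists (x, y).
by apply/orP; right; apply/mapP; exists (x, y).
Qed.

(** Without double loops, [visit_code] would embed [2 ^ k] walks of length
    [n * k + M] into a set whose size is polynomial in [k]. *)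
Lemma exp_growth_double_loop F n M : 0 < n -> finite_set F ->
  (forall k, exists W : k.-tuple bool -> nat -> X,
    (forall b, walk F (n * k + M) (W b)) /\
    (forall b b', agree (n * k + M).+1 (W b) (W b') -> b = b')) ->
  has_double_loop F.
Proof.
move=> n0 /finite_vertices[vs Fvs] growth; apply: contrapT => nF.
have [k kvs] := poly_lt_exp n M (size vs).
have k0 : 0 < k.
  case: k kvs => //; rewrite expn0 ltnS leqn0 expn_eq0 => /andP[/eqP]; lia.
have [W [FW Winj]] := growth k.
have cinj : injective (fun b => visit_code vs (n * k + M) (W b)).
  move=> b b' /(visit_code_inj nF (FW b) (FW b')) H; apply/Winj/H => i im.
  have [i0|] := posnP i; first by rewrite i0; case: (Fvs _ _ (FW b 0 _)) => //; nia.
  by case: i im => // i im _; case: (Fvs _ _ (FW b i im)).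
have := leq_card _ cinj; rewrite card_visit_code card_tuple card_bool; lia.
Qed.

(** The form of turbulence shared by finite and infinite paths.  The walks in
    [S] are known on the window [[0, M]]; each of them can be prolonged backwards
    by [n] steps, inside [K true] or inside [K false], to a walk whose own
    initial window is again that of a member of [S].  After [k] prolongations the
    [2 ^ k] choices give different walks, since walks of [K true] and [K false]
    differ on [[0, n + M]].  For finite paths [M = 0] suffices; for infinite
    ones [M] is the length at which two disjoint closed sets are separated. *)
Lemma branching_double_loop F n M (S : set (nat -> X)) (K : bool -> set (nat -> X)) :
  0 < n -> finite_set F -> S !=set0 ->
  (forall s, S s -> walk F M s) ->
  (forall b k, K b k -> S k /\ walk F (n + M) k) ->
  (forall k l, K true k -> K false l -> ~ agree (n + M).+1 k l) ->
  (forall b s, S s -> exists2 k, K b k & agree M.+1 (fun i => k (n + i)) s) ->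
  has_double_loop F.
Proof.
move=> n0 finF [s0 Ss0] SF KF dK ext.
have /choice[g gP] : forall bs : bool * (nat -> X), exists k, S bs.2 ->
    K bs.1 k /\ agree M.+1 (fun i => k (n + i)) bs.2.
  move=> [b s]; have [Ss|nSs] := pselect (S s); last by exists s.
  by have [k Kk ks] := ext b s Ss; exists k.
(* [build bs s] prolongs [s] backwards, the head of [bs] being the first choice;
   [glue] places the walk [r] built from [k] before the walk [k] itself. *)
pose glue m (r k : nat -> X) := fun i => if i < m then r i else k (i - m).
pose build := fix build (bs : seq bool) s := if bs is b :: bs'
  then glue (n * size bs') (build bs' (g (b, s))) (g (b, s)) else s.
have buildP bs s : S s -> walk F (n * size bs + M) (build bs s) /\
    forall i, i <= M -> build bs s (n * size bs + i) = s i.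
  elim: bs s => [|b bs IH] s Ss /=.
    by rewrite muln0; split=> //; exact: SF.
  have [Kk ks] := gP (b, s) Ss; have [Sk Fk] := KF _ _ Kk.
  set k := g (b, s) in Kk ks Sk Fk *; have [Fr rk] := IH k Sk.
  set r := build bs k in Fr rk *; set m := n * size bs in Fr rk *.
  have -> : n * (size bs).+1 = m + n by rewrite mulnS addnC.
  split=> i iM; rewrite /glue; last first.
    by rewrite -addnA ifN ?addKn -?leqNgt ?leq_addr //; exact: ks.
  have [im|mi] := ltnP i.+1 m; first by rewrite (ltnW im); apply: Fr; lia.
  have [im|{}mi] := ltnP i m; last by rewrite subSn//; apply: Fk; lia.
  (* the junction: the end of [r] is the start of [k] *)
  have -> : i.+1 = m + 0 by lia.
  rewrite addKn -(rk 0 (leq0n _)); have -> : m + 0 = i.+1 by lia.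
  by apply: Fr; lia.
have build_inj bs bs' s : S s -> size bs = size bs' ->
    agree (n * size bs + M).+1 (build bs s) (build bs' s) -> bs = bs'.
  elim: bs bs' s => [|b bs IH] [|b' bs']//= s Ss [szE].
  rewrite -szE /glue mulnS => H.
  have [Kk _] := gP (b, s) Ss; have [Kk' _] := gP (b', s) Ss.
  have kk' : agree (n + M).+1 (g (b, s)) (g (b', s)).
    move=> i iM; have := H (n * size bs + i).
    by rewrite !ifN ?addKn -?leqNgt ?leq_addr //; apply; lia.
  have bb' : b = b'.
    move: Kk Kk' kk'; case: b b' {H} => -[] //= Kk Kk' kk'.
      by case: (dK _ _ Kk Kk').
    by case: (dK _ _ Kk' Kk) => i /kk'.
  rewrite -bb' in H kk' *; have [Sk _] := KF _ _ Kk.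
  congr (_ :: _); apply: (IH _ (g (b, s))) => // i iM.
  have [im|mi] := ltnP i (n * size bs).
    by have := H i; rewrite im; apply; lia.
  rewrite -(subnKC mi) (buildP _ _ Sk).2; last by lia.
  by rewrite szE (buildP _ _ Sk).2//; lia.
apply: (@exp_growth_double_loop F n M n0 finF) => k.
exists (fun b => build b s0); split=> [b|b b' H].
  by have := (buildP b _ Ss0).1; rewrite size_tuple.
by apply/val_inj/(build_inj _ _ s0); rewrite ?size_tuple.
Qed.

Lemma periodic_walk F a w : 0 < a -> w a = w 0 -> (forall i, F (w i, w i.+1)) ->
  forall i, F (w (i %% a), w (i.+1 %% a)).
Proof.
move=> a0 wa Fw i; have := ltn_pmod i a0; rewrite leq_eqVlt => /orP[/eqP iaE|ia].
  suff -> : w (i.+1 %% a) = w (i %% a).+1 by [].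
  by rewrite iaE wa -addn1 -modnDml addn1 iaE modnn.
have -> : i.+1 %% a = (i %% a).+1 by rewrite -addn1 -modnDml addn1 modn_small.
exact: Fw.
Qed.

(** If [w] is back at its origin at time [a] and [w'] at time [b], repeating the
    loop of [w] [b] times and that of [w'] [a] times gives two closed walks of
    length [a * b], which must coincide.  Both [a] and [b] can be taken larger
    than any given time. *)
Lemma recurrent_walk_unique F w w' : ~ has_double_loop F ->
  (forall i, F (w i, w i.+1)) -> (forall i, F (w' i, w' i.+1)) -> w 0 = w' 0 ->
  (forall N, exists2 i, N < i & w i = w 0) ->
  (forall N, exists2 i, N < i & w' i = w' 0) ->
  w =1 w'.
Proof.
move=> nF Fw Fw' ww' rw rw' t.
have [a ta wa] := rw t; have [b tb wb] := rw' t.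
have a0 : 0 < a by lia.
have b0 : 0 < b by lia.
suff : w (t %% a) = w' (t %% b) by rewrite !modn_small.
apply: (@unique_return X F (a * b) (fun i => w (i %% a)) (fun i => w' (i %% b))
  0 (a * b) nF) => //; rewrite ?modnMr ?modnMl ?mod0n //; last by nia.
- by move=> i _; exact: (periodic_walk a0 wa Fw).
- by move=> i _; exact: (periodic_walk b0 wb Fw').
Qed.

(** An infinite walk visits some vertex infinitely often; cut it at a time [r]
    when it is at such a vertex.  By [recurrent_walk_unique] the walk is
    determined by its initial segment up to [r], and there are countably many
    such segments. *)
Lemma countable_walks F : finite_set F -> ~ has_double_loop F ->
  countable [set w : nat -> X | forall i, F (w i, w i.+1)].
Proof.
move=> /finite_vertices[vs Fvs] nF.
have rec w : (forall i, F (w i, w i.+1)) ->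
    exists i0, forall N, exists2 i, N < i & w i = w i0.
  move=> Fw; apply: contrapT => /forallNP H.
  have /choice[B BP] : forall i0, exists N, forall i, N < i -> w i <> w i0.
    move=> i0; apply: contrapT => /forallNP H'; apply: (H i0) => N.
    apply: contrapT => H''; apply: (H' N) => i Ni wi; apply: H''.
    by exists i.
  (* If no vertex recurred, all of them would have been left for good at some
     time [C]. *)
  have [C CP] : exists C, forall v, v \in vs -> forall i, C < i -> w i <> v.
    elim: (vs) => [|v vs' [C CP]]; first by exists 0.
    have [[i0 wi0]|nv] := pselect (exists i, w i = v).
      exists (maxn C (B i0)) => u; rewrite inE => uv i; rewrite gtn_max => /andP[Ci Bi].
      case/orP: uv => [/eqP ->|/CP]; last exact.
      by rewrite -wi0; exact: BP.
    exists C => u; rewrite inE => /orP[/eqP -> i _ wi|/CP//].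
    by apply: nv; exists i.
  exact: (CP _ (Fvs _ _ (Fw C.+1)).1 C.+1).
have /choice[r rP] : forall w, exists i0, (forall i, F (w i, w i.+1)) ->
    forall N, exists2 i, N < i & w i = w i0.
  move=> w; have [Fw|nFw] := pselect (forall i, F (w i, w i.+1)); last by exists 0.
  by have [i0 H] := rec _ Fw; exists i0.
apply/countable_injP.
exists (fun w => pickle (map (fun v => index v vs) (mkseq w (r w).+1))).
move=> w w' /set_mem Fw /set_mem Fw' /(pcan_inj pickleK) H.
have rE : r w = r w'.
  by move/(congr1 size): H; rewrite /= !size_map !size_iota => -[].
have ww' i : i <= r w -> w i = w' i.
  move=> ir; have := congr1 (fun s => nth 0 s i) H.
  rewrite !(nth_map (w 0)) ?size_mkseq -?rE// !nth_mkseq -?rE//.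
  have := (Fvs _ _ (Fw i)).1; have := (Fvs _ _ (Fw' i)).1 => v1 v2.
  by move=> /(congr1 (nth (w i) vs)); rewrite !nth_index.
have shifted : (fun i => w (r w + i)) =1 (fun i => w' (r w + i)).
  apply: (recurrent_walk_unique nF) => [i|i||N|N]; rewrite ?addnS ?addn0 //.
  - exact: ww'.
  - have [i Ni wi] := rP _ Fw (r w + N).
    by exists (i - r w); [lia|rewrite subnKC//; lia].
  - have [i Ni wi] := rP _ Fw' (r w + N).
    by exists (i - r w); [lia|rewrite subnKC ?rE//; lia].
apply/funext => t; have [|/ltnW tr] := leqP t (r w); first exact: ww'.
by rewrite -(subnKC tr); exact: shifted.
Qed.

(** The concatenation of copies of [p] and [q] chosen by the bits of [s]. *)
Definition splice n p q (s : nat -> bool) : nat -> X :=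
  fun i => (if s (i %/ n) then p else q) (i %% n).

(** The bound [j <= n], instead of [j < n], is what makes the blocks fit
    together: the end of a block is the start of the next one. *)
Lemma spliceE F n p q s k j : double_loop F n p q -> j <= n ->
  splice n p q s (k * n + j) = (if s k then p else q) j.
Proof.
move=> [n0 _ pq [pn qn] _]; rewrite /splice leq_eqVlt => /orP[/eqP->|jn].
  rewrite -mulSnr mulnK// modnMl.
  by case: (s k.+1); case: (s k); congruence.
by rewrite divnMDl// divn_small// addn0 modnMDl modn_small.
Qed.

Lemma splice_walk F n p q s : double_loop F n p q ->
  forall i, F (splice n p q s i, splice n p q s i.+1).
Proof.
move=> dl i; have [n0 [Fp Fq] _ _ _] := dl.
have jn := ltn_pmod i n0; rewrite (divn_eq i n) -addnS !(spliceE _ _ dl)//.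
  by case: (s _); [exact: Fp|exact: Fq].
exact: ltnW.
Qed.

End Growth.

(** * The topology of the path space *)

(** The filter generated by the sets [agree M f] converges to [f] in each
    coordinate, hence in the product topology. *)
Lemma nbhs_prod_cylinder (X : topologicalType)
    (f : prod_topology (fun _ : nat => X)) (U : set (prod_topology (fun _ : nat => X))) :
  nbhs f U -> exists M, forall w, agree M f w -> U w.
Proof.
pose G := filter_from [set: nat]
  (fun M => [set w : prod_topology (fun _ : nat => X) | agree M f w]).
have FG : Filter G.
  apply: filter_from_filter => [|i j _ _]; first by exists 0.
  exists (maxn i j) => // w fw.
  by split=> k ki; apply: fw; rewrite leq_max ki ?orbT.
suff : G --> f by move=> /[apply] -[M _ MU]; exists M => w /MU.
apply/cvg_sup => i; move=> A.
rewrite /= (@nbhsE (initial_topology (@proj _ (fun _ => X) i))).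
move=> -[_ [[B Bop <-] Bf] BA].
by exists i.+1 => // w fw; apply: BA => /=; rewrite /proj -fw.
Qed.

Lemma continuous_locally_constant (X T : topologicalType)
    (f : T -> prod_topology (fun _ : nat => X)) :
  (forall t i, \forall t' \near t, f t' i = f t i) -> continuous f.
Proof.
move=> fc t U /nbhs_prod_cylinder[M MU].
suff : \forall t' \near t, agree M (f t) (f t') by apply: filterS => t' /MU.
elim: M {MU} => [|M IH]; first by near=> z'; case.
near=> z'; move=> i; rewrite ltnS leq_eqVlt => /orP[/eqP ->|].
  by symmetry; near: z'; apply: (fc t M).
by move: i; near: z'.
Unshelve. all: by end_near. Qed.

Lemma compact_set_type (T : topologicalType) (A : set T) :
  compact A -> compact [set: set_type A].
Proof.
move=> /compact_near_coveringP cA; apply/compact_near_coveringP => J F P FF cover.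
have /cA : forall x, A x -> \forall x' \near x & i \near F,
    forall Ax' : x' \in A, P i (exist _ x' Ax').
  move=> x /mem_set Ax; have [[U V] /= [Ux FV] UV] := cover (exist _ x Ax) I.
  have := Ux; rewrite nbhsE => -[_ [[B Bop <-] Bx] BU].
  exists (B, V); first by split=> //; exact: open_nbhs_nbhs.
  move=> [x' i] /= [Bx' Vi] Ax'.
  by apply: (UV (_, i)); split=> //; exact: BU.
by apply: filterS => i H [x Ax] _; apply: H; exact: set_mem.
Qed.

Section PathSpace.
Context {R : realType} {X : metricType R} (F : set (X * X)).
Hypothesis finF : finite_set F.
Let Z : topologicalType := set_type (infinite_paths F).
Implicit Types (z : Z) (M : nat).

Lemma walk_val z i : F (set_val z i, set_val z i.+1).
Proof. exact: (set_mem (valP z)). Qed.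

Lemma iter_shift n z i : set_val (iter n (@shift_map R X F) z) i = set_val z (n + i).
Proof. by elim: n i => //= n IH i; rewrite [LHS]IH addSnnS. Qed.

Lemma coord_continuous i : continuous (fun z => set_val z i : X).
Proof.
move=> z.
apply: (@continuous_comp Z (prod_topology (fun _ : nat => X)) X set_val (proj i)).
  exact: initial_continuous.
exact: (@proj_continuous _ (fun _ => X)).
Qed.

Lemma nbhs_cylinder z (U : set Z) : nbhs z U ->
  exists M, forall z', agree M (set_val z) (set_val z') -> U z'.
Proof.
rewrite nbhsE => -[_ [[B Bop <-] Bz] BU].
have /nbhs_prod_cylinder[M MB] : nbhs (set_val z) B by exact: open_nbhs_nbhs.
by exists M => z' zz'; apply: BU; apply: MB.
Qed.

(** The other vertices of the graph form a finite, hence closed, set. *)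
Lemma near_coord z i : \forall z' \near z, set_val z' i = set_val z i.
Proof.
have [vs Fvs] := finite_vertices finF.
pose A : set X := [set x | x \in vs /\ x <> set_val z i].
have finA : finite_set A.
  by apply: (sub_finite_set (B := [set` vs])) => [x []//|]; exact: finite_seq.
have clA : closed A.
  apply: (accessible_finite_set_closed.1 _) finA.
  exact/hausdorff_accessible/metric_hausdorff.
have : nbhs (set_val z i : X) (~` A).
  apply: open_nbhs_nbhs; split; first exact: closed_openC.
  by move=> [_ /(_ erefl)].
move=> /(@coord_continuous i z) nz.
have {}nz : nbhs z [set z' : Z | (~` A) (set_val z' i)] := nz.
apply: filterS nz => z' /= nA.
apply: contrapT => zz'; apply: nA; split=> //.
by have [] := Fvs _ _ (walk_val z' i).
Qed.

Lemma near_agree z M : \forall z' \near z, agree M (set_val z) (set_val z').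
Proof.
elim: M => [|M IH]; first by near=> z'; case.
near=> z'; move=> i; rewrite ltnS leq_eqVlt => /orP[/eqP ->|].
  by symmetry; near: z'; apply: (near_coord z M).
by move: i; near: z'.
Unshelve. all: by end_near. Qed.

Lemma continuous_path_space (T : topologicalType) (f : T -> Z) :
  (forall t i, \forall t' \near t, set_val (f t') i = set_val (f t) i) ->
  continuous f.
Proof.
move=> fc; apply: continuous_comp_initial.
exact: (@continuous_locally_constant X T (set_val \o f)).
Qed.

Hypothesis compactX : compact [set: X].

(** A closed subset of a compact product: the condition on the coordinates [i]
    and [i.+1] is a finite union, over the edges, of closed conditions. *)
Lemma compact_path_space : compact [set: Z].
Proof.
apply: compact_set_type.
apply: (@subclosed_compact (prod_topology (fun _ : nat => X)) _
  [set w | forall i, [set: X] (w i)]) => //; last first.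
  exact: (@tychonoff nat (fun _ => X) (fun _ => [set: X])).
rewrite (_ : infinite_paths F = \bigcap_i
    [set w : prod_topology (fun _ => X) | F (w i, w i.+1)]); last first.
  by apply/seteqP; split=> w Fw i => [_|]; apply: Fw.
apply: closed_bigI => i _.
have cl1 (j : nat) (a : X) : closed [set w : prod_topology (fun _ : nat => X) | w j = a].
  apply: (@closed_comp (prod_topology (fun _ : nat => X)) X (proj j) [set a]) => [w _|].
    exact: (@proj_continuous _ (fun _ => X)).
  exact/accessible_closed_set1/hausdorff_accessible/metric_hausdorff.
rewrite (_ : [set w | _] = \bigcup_(e in F)
  ([set w : prod_topology (fun _ => X) | w i = e.1] `&` [set w | w i.+1 = e.2])).
  by apply: closed_bigcup => // e _; apply: closedI.
apply/seteqP; split=> [w Fw|w [[a b] Fe [/= -> ->]]] //.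
by exists (w i, w i.+1).
Qed.

End PathSpace.

Local Open Scope ring_scope.

Lemma hausdorff_set_type (T : topologicalType) (A : set T) :
  hausdorff_space T -> hausdorff_space (set_type A).
Proof.
move=> hT p q pq; apply: val_inj; apply: hT => U V pU qV.
have [x [Ux Vx]] := pq (set_val @^-1` U) (set_val @^-1` V)
  (@initial_continuous _ _ set_val p U pU) (@initial_continuous _ _ set_val q V qV).
by exists (set_val x).
Qed.

(** * Turbulence and finite paths *)

Section FinitePaths.
Context {R : realType} {X : metricType R} (F : set (X * X)).

Definition fin_walk n (x : set_type (finite_paths F n)) : nat -> X :=
  fun i => set_val x (inord i).

Lemma fin_walkP n x : walk F n (@fin_walk n x).
Proof.
move=> i im; have := set_mem (valP x) (Ordinal im); rewrite /fin_walk.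
set a := inord i; set b := inord i.+1.
rewrite (_ : widen_ord _ _ = a); last by apply/val_inj; rewrite /= inordK// ltnW.
rewrite (_ : lift _ _ = b) //; apply/val_inj; rewrite /= inordK//.
Qed.

Lemma fin_walk_inj n x y : agree n.+1 (@fin_walk n x) (@fin_walk n y) -> x = y.
Proof.
move=> xy; apply/val_inj/funext => i.
by have := xy i (ltn_ord i); rewrite /fin_walk inord_val.
Qed.

Lemma fin_walk0 n x : @fin_walk n x 0%N = path_coord ord0 x.
Proof.
rewrite /fin_walk /path_coord (_ : inord _ = ord0)//.
by apply/val_inj; rewrite /= inordK.
Qed.

Lemma fin_walk_max n x : @fin_walk n x n = path_coord ord_max x.
Proof.
rewrite /fin_walk /path_coord (_ : inord _ = ord_max)//.
by apply/val_inj; rewrite /= inordK.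
Qed.

Lemma walk_finite_paths n w : walk F n w ->
  (fun i : 'I_n.+1 => w i) \in finite_paths F n.
Proof. by move=> Fw; apply/mem_set => i /=; rewrite /bump; apply: Fw. Qed.

Definition path_of_walk n w (Fw : walk F n w) : set_type (finite_paths F n) :=
  exist (fun x => x \in finite_paths F n) _ (walk_finite_paths Fw).

Lemma path_of_walkE n w (Fw : walk F n w) i :
  path_coord i (path_of_walk Fw) = w i.
Proof. by []. Qed.

Lemma double_loop_pathsP :
  (exists2 n : nat, (0 < n)%N & exists x y : set_type (finite_paths F n),
     [/\ x <> y, path_coord ord0 x = path_coord ord0 y,
         path_coord ord0 y = path_coord ord_max x &
         path_coord ord_max x = path_coord ord_max y])
  <-> has_double_loop F.
Proof.
split=> [[n n0 [x [y [xy xy0 yx xyn]]]]|[n [p [q [n0 [Fp Fq] pq [pn qn] npq]]]]].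
  exists n, (fin_walk x), (fin_walk y).
  split; rewrite ?fin_walk0 ?fin_walk_max//.
  - by split; exact: fin_walkP.
  - by split; congruence.
  - by move/fin_walk_inj.
exists n => //; exists (path_of_walk Fp), (path_of_walk Fq).
rewrite !path_of_walkE/=; split; try congruence.
move=> pqE; apply: npq => i im.
by have := path_of_walkE Fp (Ordinal im); rewrite pqE path_of_walkE.
Qed.

(** Two singletons do, since all four projections are the common base point. *)
Lemma double_loop_CR_turbulent : has_double_loop F -> CR_turbulent F.
Proof.
move=> [n [p [q [n0 [Fp Fq] pq [pn qn] npq]]]].
exists n => //; exists [set path_of_walk Fp], [set path_of_walk Fq].
have cl1 (x : set_type (finite_paths F n)) : closed [set x].
  apply/accessible_closed_set1/hausdorff_accessible/hausdorff_set_type.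
  by apply: hausdorff_product => _; exact: metric_hausdorff.
split => //.
- by split; [exists (path_of_walk Fp)|exists (path_of_walk Fq)].
- apply/seteqP; split=> // x [/= -> pqE]; apply: npq => i im.
  by have := path_of_walkE Fp (Ordinal im); rewrite pqE path_of_walkE.
- move=> _ [[_ -> <-]|[_ -> <-]]; rewrite path_of_walkE; split.
  + by exists (path_of_walk Fp).
  + by exists (path_of_walk Fq) => //; rewrite path_of_walkE/=; congruence.
  + by exists (path_of_walk Fp) => //; rewrite path_of_walkE/=; congruence.
  + by exists (path_of_walk Fq).
Qed.

(** A path is prolonged backwards by a path of [K] or of [L] that ends where the
    given one starts. *)
Lemma CR_turbulent_double_loop :
  finite_set F -> CR_turbulent F -> has_double_loop F.
Proof.
move=> finF [n n0 [K [L [_ [[x Kx] _] KL0 KL]]]].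
pose A := path_coord ord0 @` K `|` path_coord ord0 @` L.
apply: (@branching_double_loop _ F n 0 [set w | A (w 0%N)]
  (fun b => @fin_walk n @` (if b then K else L))) => //.
- by exists (fin_walk x); rewrite /= fin_walk0; left; exists x.
- move=> b _ [k Kk <-]; split; last by rewrite addn0; exact: fin_walkP.
  by rewrite /= fin_walk0; case: b Kk => Kk; [left|right]; exists k.
- move=> _ _ [k Kk <-] [l Ll <-]; rewrite addn0 => /fin_walk_inj kl.
  by rewrite kl in Kk; have : (K `&` L) l by []; rewrite KL0.
- move=> b s /KL[[k Kk ks] [l Ll ls]].
  exists (fin_walk (if b then k else l)).
    by exists (if b then k else l) => //; case: b.
  by move=> [|//] _; rewrite addn0 fin_walk_max; case: b.
Qed.

End FinitePaths.

(** * Turbulence of the shift *)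

Section PathSpaceDynamics.
Context {R : realType} {X : metricType R} (F : set (X * X)).
Hypotheses (finF : finite_set F) (compactX : compact [set: X]).
Let Z : topologicalType := set_type (infinite_paths F).
Let sigma := @shift_map R X F.

(** The Lebesgue number lemma, with cylinders in place of balls. *)
Lemma cylinder_refines (alpha : set (set Z)) :
  (forall z : Z, exists2 A, alpha A & nbhs z A) ->
  exists M, forall z : Z, exists2 A, alpha A &
    forall z' : Z, agree M (set_val z) (set_val z') -> A z'.
Proof.
move=> alphaZ.
pose P M (z : Z) := exists2 A, alpha A &
    forall z' : Z, agree M (set_val z) (set_val z') -> A z'.
have /compact_near_coveringP/(_ nat \oo P) := compact_path_space finF compactX.
case=> [z _|M _ /(_ M (leqnn M)) H]; last by exists M => z; exact: H.
have [A alphaA zA] := alphaZ z; have [M MA] := nbhs_cylinder zA.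
exists ([set z' : Z | agree M (set_val z) (set_val z')], [set i | (M <= i)%N]).
  by split; [exact: near_agree|exists M].
move=> [z' i] /= [zz' Mi]; exists A => // y z'y; apply: MA => j jM.
by rewrite zz'// z'y// (leq_trans jM).
Qed.

Lemma hausdorff_path_space : hausdorff_space Z.
Proof.
apply: hausdorff_set_type.
by apply: hausdorff_product => _; exact: metric_hausdorff.
Qed.

(** The points of [K] and [L] differ on a window of uniform length [M], so that
    choosing preimages in [K] or in [L] is a backward branching. *)
Lemma separated_turbulent_double_loop n : (0 < n)%N ->
  separated_turbulent (iter n sigma) -> has_double_loop F.
Proof.
move=> n0 [K [L [[clK clL] [[x Kx] _] KL0 KL]]].
have [M MP] : exists M, forall z : Z, exists2 A, [set ~` K; ~` L] A &
    forall z' : Z, agree M (set_val z) (set_val z') -> A z'.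
  apply: cylinder_refines => z; have [Kz|nKz] := pselect (K z).
    exists (~` L); first by right.
    apply: open_nbhs_nbhs; split; first exact: closed_openC.
    by move=> Lz; have : (K `&` L) z by []; rewrite KL0.
  exists (~` K); first by left.
  by apply: open_nbhs_nbhs; split; first exact: closed_openC.
apply: (@branching_double_loop _ F n M (set_val @` (K `|` L))
  (fun b => set_val @` (if b then K else L))) => //.
- by exists (set_val x); exists x => //; left.
- by move=> _ [z _ <-] i _; exact: walk_val.
- move=> b _ [k Kk <-]; split; last by move=> i _; exact: walk_val.
  by exists k => //; case: b Kk => Kk; [left|right].
- move=> _ _ [k Kk <-] [l Ll <-] kl; have [A [->|->] kA] := MP k.
    by apply: (kA k).
  apply: (kA l) => // i iM; apply: kl.
  by rewrite ltnS (leq_trans (ltnW iM))// leq_addl.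
- move=> b _ [z /KL[[k Kk kz] [l Ll lz]] <-].
  exists (set_val (if b then k else l)).
    by exists (if b then k else l) => //; case: b.
  by move=> i _; rewrite -iter_shift; case: b; rewrite ?kz ?lz.
Qed.

Section Coding.
Variables (n : nat) (p q : nat -> X).
Hypothesis pqF : double_loop F n p q.

Lemma splice_infinite_paths s : splice n p q s \in infinite_paths F.
Proof. by apply/mem_set; exact: splice_walk. Qed.

Definition coding (s : cantor_space) : Z :=
  exist (fun z => z \in infinite_paths F) _ (splice_infinite_paths s).

Lemma coding_val s i : set_val (coding s) i = splice n p q s i.
Proof. by []. Qed.

Lemma codingE s k j : (j <= n)%N ->
  set_val (coding s) (k * n + j) = (if s k then p else q) j.
Proof. exact: spliceE pqF. Qed.

Lemma near_bit (s : cantor_space) k : \forall s' \near s, s' k = s k.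
Proof.
have : nbhs (s k) [set s k].
  by [].
by move=> /(@proj_continuous _ (fun _ : nat => bool) k s).
Qed.

Lemma coding_continuous : continuous coding.
Proof.
apply: continuous_path_space => s i; near=> s'.
rewrite !coding_val /splice (_ : s' (i %/ n)%N = s (i %/ n)%N)//.
by near: s'; exact: (near_bit s).
Unshelve. all: by end_near. Qed.

(** The [n]-th power of the shift deletes the first block, and any bit can be
    put back in front; so it maps the codes of the sequences starting with a
    given bit onto all codes. *)
Lemma double_loop_separated_turbulent : separated_turbulent (iter n sigma).
Proof.
pose K b := coding @` [set s | s 0%N = b].
have n0 : (0 < n)%N by case: pqF.
have clK b : closed (K b).
  apply: (compact_closed hausdorff_path_space).
  apply: (@continuous_compact cantor_space Z coding).
    by apply: continuous_subspaceT; exact: coding_continuous.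
  apply: (subclosed_compact _ cantor_space_compact) => //.
  rewrite -openC openE => s /= sb; apply: filterS (near_bit s 0) => s' /=.
  by move->.
have shiftK b z : range coding z -> (iter n sigma @` K b) z.
  move=> [s _ <-]; pose s' : cantor_space := fun i => if i is i'.+1 then s i' else b.
  exists (coding s'); first by exists s'.
  apply/val_inj/funext => i; rewrite [LHS]iter_shift !coding_val /splice.
  have -> : (n + i = 1 * n + i)%N by rewrite mul1n.
  by rewrite divnMDl// modnMDl.
exists (K true), (K false); split=> //.
- split; first by exists (coding (fun=> true)); exists (fun=> true).
  by exists (coding (fun=> false)); exists (fun=> false).
- apply/seteqP; split=> // z [[s s0 <-] [s' s'0 E]].
  have [_ _ _ _] := pqF; apply=> i; rewrite ltnS => im.
  have := codingE s 0 im; have := codingE s' 0 im.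
  by rewrite E s0 s'0 => -> ->.
- by move=> z [[s _ <-]|[s _ <-]]; split; apply: shiftK.
Qed.

End Coding.

End PathSpaceDynamics.

(** * Entropy *)

(** Fekete's lemma, for a sequence whose term of index [m] belongs to [m.+1]
    successive times; this is the indexing of the joins in the definition of
    entropy and explains the successors. *)
Lemma subadditive_cvg (R : realType) (u : nat -> R) :
  (forall m, 0 <= u m) -> (forall a b, u (a + b).+1 <= u a + u b) ->
  exists c : R, [/\ 0 <= c, forall m, c * m.+1%:R <= u m &
    (fun m => u m / m%:R) @ \oo --> c].
Proof.
move=> u0 uD; pose S := [set u m / m.+1%:R | m in [set: nat]].
have S0 : lbound S 0 by move=> _ [m _ <-]; rewrite divr_ge0.
have Sne : S !=set0 by exists (u 0%N / 1%:R), 0%N.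
have Slb : has_lbound S by exists 0.
exists (inf S).
have cu m : inf S * m.+1%:R <= u m.
  by rewrite -ler_pdivlMr ?ltr0n//; apply: ge_inf => //; exists m.
have c0 : 0 <= inf S by exact: lb_le_inf.
split=> //; apply/cvgrPdist_le => e e0.
(* Up to [e / 2] the infimum is attained at [k]; cut [m] into blocks of length
   [k.+1] and a rest, whose contribution is at most [C]. *)
have [_ [k _ <-] ke] := inf_adherent (divr_gt0 e0 (ltr0n _ 2)) (conj Sne Slb).
set c := inf S in cu c0 ke *.
pose C : R := \sum_(r < k.+1) u r.
have C0 : 0 <= C by apply: sumr_ge0.
have uq q r : u (q * k.+1 + r)%N <= q%:R * u k + u r.
  elim: q => [|q IH]; first by rewrite mul0n mul0r add0r.
  have -> : (q.+1 * k.+1 + r = (k + (q * k.+1 + r)).+1)%N by lia.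
  by have := uD k (q * k.+1 + r)%N; rewrite -natr1; lra.
have uk : u k < (c + e / 2) * k.+1%:R by rewrite -ltr_pdivrMr ?ltr0n.
near=> m.
have m0 : 0 < m%:R :> R by rewrite ltr0n; near: m; exists 1%N.
have Cm : C <= e / 2 * m%:R.
  rewrite mulrC -ler_pdivrMr ?divr_gt0// ltW//.
  by near: m; exact: nbhs_infty_gtr.
have um : u m <= (c + e / 2) * m%:R + C.
  rewrite {1}(divn_eq m k.+1) (le_trans (uq _ _))// lerD//; last first.
    rewrite /C (bigD1 (Ordinal (ltn_pmod m (ltn0Sn k))))//= lerDl.
    exact: sumr_ge0.
  apply: (@le_trans _ _ ((m %/ k.+1)%N%:R * ((c + e / 2) * k.+1%:R))).
    by rewrite ler_wpM2l// ltW.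
  rewrite mulrCA; apply: ler_wpM2l; first by rewrite addr_ge0// divr_ge0// ltW.
  by rewrite -natrM ler_nat leq_divM.
have := cu m; rewrite -natr1 mulrDr mulr1 => cum.
rewrite distrC ler_norml; apply/andP; split.
  rewrite lerBrDr ler_pdivlMr//; nra.
rewrite lerBlDr ler_pdivrMr//; nra.
Unshelve. all: by end_near. Qed.

Section CoverCounting.
Local Open Scope card_scope.
Context {Z : topologicalType}.
Implicit Types (beta : set (set Z)).

Lemma subcover_enum beta n : subcover_card beta n ->
  exists2 e : 'I_n -> set Z, forall i, beta (e i) & forall z, exists i, e i z.
Proof.
move=> [gamma gb [gT /card_esym /card_set_bijP[f [fg _ fs]]]].
exists (fun i => f i) => [i|z]; first by apply/gb/fg => /=.
have [A gA Az] : (\bigcup_(A in gamma) A) z by rewrite gT.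
by have [i /= ilt fi] := fs _ gA; exists (Ordinal ilt); rewrite fi.
Qed.

Lemma subcover_family beta (E : finType) (e : E -> set Z) :
  (forall i, beta (e i)) -> (forall z, exists i, e i z) ->
  exists2 k, (k <= #|E|)%N & subcover_card beta k.
Proof.
move=> eb eZ.
pose gamma := range (fun i : 'I_#|E| => e (enum_val i)).
have gle : gamma #<= `I_#|E|.
  apply: card_le_trans (card_image_le _ _) _.
  by have := @card_II #|E|; rewrite card_eq_le => /andP[].
have [k gk] : finite_set gamma by apply: finite_image; exact: finite_finset.
exists k.
  by move: gk; rewrite card_eq_le -card_le_II => /andP[_ /card_le_trans]; apply.
exists gamma; first by move=> _ [i _ <-].
split=> //; apply/seteqP; split=> // z _; have [i iz] := eZ z.
by exists (e i) => //; exists (enum_rank i) => //; rewrite enum_rankK.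
Qed.

(** A subcover needs at most one set for each value of a code whose fibers are
    contained in elements of the cover. *)
Lemma subcover_code beta (E : finType) (code : Z -> E) :
  [set: Z] !=set0 ->
  (forall z, exists2 B, beta B & forall z', code z = code z' -> B z') ->
  exists2 k, (k <= #|E|)%N & subcover_card beta k.
Proof.
move=> [z0 _] H.
have /choice[e eP] : forall i : E, exists B, beta B /\ forall z, code z = i -> B z.
  move=> i; have [[z zi]|ni] := pselect (exists z, code z = i).
    have [B bB zB] := H z; exists B; split=> // z' z'i; apply: zB.
    by rewrite zi z'i.
  have [B bB _] := H z0; exists B; split=> // z zi; case: ni; by exists z.
apply: (@subcover_family _ E e) => [i|z]; first exact: (eP i).1.
by exists (code z); apply: (eP _).2.
Qed.

Lemma min_subcoverP (R : realType) beta : (exists n, subcover_card beta n) ->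
  exists n, [/\ subcover_card beta n, min_subcover R beta = n%:R &
                forall k, subcover_card beta k -> (n <= k)%N].
Proof.
move=> ex; have ex' : exists n, `[< subcover_card beta n >].
  by have [n bn] := ex; exists n; exact/asboolP.
case: (ex_minnP ex') => n /asboolP bn nmin; exists n.
have nle k : subcover_card beta k -> (n <= k)%N by move/asboolP/nmin.
split=> //; apply/eqP; rewrite eq_le; apply/andP; split.
  by apply: ge_inf; [exists 0 => _ [k _ <-]|exists n].
apply: lb_le_inf; first by exists n%:R, n.
by move=> _ [k bk <-]; rewrite ler_nat nle.
Qed.

Lemma subcover_card_gt0 beta n :
  [set: Z] !=set0 -> subcover_card beta n -> (0 < n)%N.
Proof. by move=> [z _] /subcover_enum[e _ /(_ z)[[i +] _]]; case: n e. Qed.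

Lemma iterated_join_submul (f : Z -> Z) alpha a b i j :
  subcover_card (iterated_join f alpha a) i ->
  subcover_card (iterated_join f alpha b) j ->
  exists2 k, (k <= i * j)%N & subcover_card (iterated_join f alpha (a + b).+1) k.
Proof.
move=> /subcover_enum[e eJ eZ] /subcover_enum[e' eJ' eZ'].
have -> : (i * j)%N = #|{: 'I_i * 'I_j}| by rewrite card_prod !card_ord.
apply: (@subcover_family _ _
  (fun x : 'I_i * 'I_j => e x.1 `&` (iter a.+1 f @^-1` e' x.2))).
  move=> [x y] /=; have [A Aa ->] := eJ x; have [B Bb ->] := eJ' y.
  exists (fun k => if (k <= a)%N then A k else B (k - a.+1)%N) => [k kab|].
    by case: leqP => ka; [exact: Aa|apply: Bb; lia].
  apply/seteqP; split=> z.
    move=> [Az Bz] k /= kab; case: leqP => ka; first exact: Az.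
    have := Bz (k - a.+1)%N.
    by rewrite /= -[f (iter a f z)]/(iter a.+1 f z) -iterD subnK//; apply; lia.
  move=> H; split=> k /= kk.
    by have := H k; rewrite /= kk; apply; lia.
  have := H (k + a.+1)%N; rewrite /= iterD addnK leqNgt ifF//; last by lia.
  by apply; lia.
move=> z; have [x ex] := eZ z; have [y ey] := eZ' (iter a.+1 f z).
by exists (x, y).
Qed.

(** Subadditivity makes the limit that defines the entropy of a cover exist.
    Its value [c] is bounded below by the growth rate along any subsequence, and
    [c > 0] forces exponential growth at every time, not only in the limit. *)
Lemma cover_entropy_fin (R : realType) (f : Z -> Z) alpha : [set: Z] !=set0 ->
  (forall m, exists n, subcover_card (iterated_join f alpha m) n) ->
  exists c : R, [/\ 0 <= c, cover_entropy R f alpha = c%:E,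
    forall m n, subcover_card (iterated_join f alpha m) n ->
      c * m.+1%:R <= ln n%:R &
    forall l : R,
      (forall N, exists2 m, (N < m)%N & forall n,
         subcover_card (iterated_join f alpha m) n -> l * m%:R <= ln n%:R) ->
      l <= c].
Proof.
move=> z0 fin; pose J := iterated_join f alpha.
have /choice[N NP] : forall m, exists n, [/\ subcover_card (J m) n,
    min_subcover R (J m) = n%:R & forall k, subcover_card (J m) k -> (n <= k)%N].
  by move=> m; apply: min_subcoverP; exact: fin.
have N0 m : (0 < N m)%N by have [+ _ _] := NP m; exact: subcover_card_gt0.
have le_lnN (i j : nat) : (0 < i)%N -> (i <= j)%N -> ln i%:R <= ln j%:R :> R.
  by move=> i0 ij; rewrite ler_ln ?ler_nat// posrE ltr0n// (leq_trans i0).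
have [||c [c0 cN cvgc]] := @subadditive_cvg R (fun m => ln (N m)%:R).
- by move=> m; rewrite ln_ge0// ler1n.
- move=> a b; have [Ja _ _] := NP a; have [Jb _ _] := NP b.
  have [k kab Jk] := iterated_join_submul Ja Jb.
  rewrite -lnM ?posrE ?ltr0n// -natrM le_lnN//.
  by have [_ _ /(_ _ Jk) /leq_trans->] := NP (a + b).+1.
exists c; split=> //.
- apply/cvg_lim => //; apply: cvg_EFin; first by near=> m.
  rewrite [X in X @ _ --> _](_ : _ = fun m => ln (N m)%:R / m%:R) //.
  by apply/funext => m /=; have [_ -> _] := NP m.
- move=> m n Jn; rewrite (le_trans (cN m))// le_lnN//.
  by have [_ _] := NP m; apply.
- move=> l H; apply/ler_addgt0Pr => e e0.
  have /cvgrPdist_le/(_ e e0)[M _ Me] := cvgc.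
  have [m Mm ml] := H M; have /= := Me m (ltnW Mm).
  have [Jm _ _] := NP m; have := ml _ Jm.
  rewrite -ler_pdivlMr; last by rewrite ltr0n; lia.
  move=> lN; rewrite distrC ler_norml => /andP[_].
  by rewrite lerBlDr addrC; exact: le_trans.
Unshelve. all: by end_near. Qed.

End CoverCounting.

Section PathEntropy.
Context {R : realType} {X : metricType R} (F : set (X * X)).
Hypotheses (finF : finite_set F) (compactX : compact [set: X]).
Let Z : topologicalType := set_type (infinite_paths F).
Let sigma : Z -> Z := @shift_map R X F.

(** The common coordinates must cover a window of length [M] at each of the
    times [0], ..., [m]. *)
Lemma iterated_join_cylinder (alpha : set (set Z)) : open_cover alpha ->
  exists M, forall m (z : Z), exists2 B, iterated_join sigma alpha m B &
    forall z' : Z, agree (m + M).+1 (set_val z) (set_val z') -> B z'.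
Proof.
move=> [aop acov].
have [|M HM] := @cylinder_refines _ _ _ finF compactX alpha.
  move=> z; have [A aA Az] : (\bigcup_(A in alpha) A) z by rewrite acov.
  by exists A => //; apply: open_nbhs_nbhs; split=> //; exact: aop.
have /choice[A AP] : forall z : Z, exists A, alpha A /\
    forall z' : Z, agree M (set_val z) (set_val z') -> A z'.
  by move=> z; have [A] := HM z; exists A.
exists M => m z.
exists (\bigcap_(i in [set i | (i <= m)%N]) (iter i sigma @^-1` A (iter i sigma z))).
  by exists (fun i => A (iter i sigma z)) => // i _; exact: (AP _).1.
move=> z' zz' i /= im; apply: (AP _).2 => j jM.
by rewrite !iter_shift; apply: zz'; lia.
Qed.

Lemma iterated_join_finite (alpha : set (set Z)) : [set: Z] !=set0 ->
  open_cover alpha -> forall m, exists n, subcover_card (iterated_join sigma alpha m) n.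
Proof.
move=> Z0 /iterated_join_cylinder[M HM] m; have [vs Fvs] := finite_vertices finF.
pose code (z : Z) := [ffun i : 'I_(m + M).+1 =>
  inord (index (set_val z i) vs) : 'I_(size vs).+1].
have [|k _] := @subcover_code _ (iterated_join sigma alpha m) _ code Z0; last by exists k.
move=> z; have [B JB zB] := HM m z; exists B => // z' /ffunP zz'; apply: zB => i im.
have := zz' (Ordinal im); rewrite !ffunE /=.
have [zv _] := Fvs _ _ (walk_val z i); have [zv' _] := Fvs _ _ (walk_val z' i).
move=> /(congr1 val); rewrite /= !inordK ?ltnS ?index_size// => E.
by rewrite -(nth_index (set_val z i) zv) E nth_index.
Qed.

(** Without double loops the joins have subcovers of polynomial size, one set for
    each [visit_code]; a cover of positive entropy would need [2 ^ k] sets at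
    time [A * k], for a suitable [A]. *)
Lemma entropy_double_loop : entropy R sigma <> 0%E -> has_double_loop F.
Proof.
move=> ent; apply: contrapT => nF; apply: ent; rewrite /entropy.
case: asboolP => // ne.
have Z0 : [set: Z] !=set0.
  by apply/set0P/eqP.
suff c0 alpha : open_cover alpha -> cover_entropy R sigma alpha = 0%E.
  rewrite (_ : [set _ | _ in _] = [set 0%E]) ?ereal_sup1//.
  apply/seteqP; split=> [_ [alpha oa <-]|_ ->]; first by rewrite /= c0.
  have oT : open_cover [set [set: Z]].
    by split=> [_ ->|]; [exact: openT|rewrite bigcup_set1].
  by exists [set [set: Z]] => //; exact: c0.
move=> oa; have [M HM] := iterated_join_cylinder oa.
have [c [c0 -> cN _]] := cover_entropy_fin R Z0 (iterated_join_finite Z0 oa).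
congr EFin; apply/eqP; rewrite eq_le c0 andbT leNgt; apply/negP => cpos.
have [vs Fvs] := finite_vertices finF.
have [A cA] : exists A : nat, ln 2 <= A%:R * c.
  exists (Num.bound (ln 2 / c)); rewrite -ler_pdivrMr//.
  by apply/ltW/archi_boundP; rewrite divr_ge0// ln_ge0// ler1n.
have [k kvs] := poly_lt_exp A M (size vs).
have [|n nle Jn] := @subcover_code _ (iterated_join sigma alpha (A * k)) _
    (fun z : Z => visit_code vs (A * k + M) (set_val z)) Z0.
  move=> z; have [B JB zB] := HM (A * k)%N z; exists B => // z' zz'; apply: zB.
  apply: (visit_code_inj nF _ _ _ zz') => i _; try exact: walk_val.
  by have [] := Fvs _ _ (walk_val z i).
rewrite card_visit_code in nle.
have n0 := subcover_card_gt0 Z0 Jn.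
have : ln (2 ^ k)%:R <= ln n%:R :> R.
  apply: le_trans (cN _ _ Jn); rewrite natrX lnXn// -[ln 2 *+ k]mulr_natr.
  have : ln 2 * k%:R <= A%:R * c * k%:R by rewrite ler_wpM2r.
  move=> /le_trans; apply; rewrite -[(A * k).+1%:R]natr1 natrM mulrDr mulr1.
  by rewrite mulrA [c * _]mulrC lerDl ltW.
by rewrite ler_ln ?posrE ?ltr0n ?expn_gt0// ler_nat; lia.
Qed.

(** For the partition by the first coordinate, an element of the join at time
    [n * k] determines the first [k] blocks of a coded sequence. *)
Lemma double_loop_entropy n p q : double_loop F n p q -> entropy R sigma <> 0%E.
Proof.
move=> pqF; have [n0 _ _ _ npq] := pqF.
have Z0 : [set: Z] !=set0 by exists (coding pqF (fun=> true)).
pose alpha := range (fun v : X => [set z : Z | set_val z 0%N = v]).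
have oa : open_cover alpha.
  split.
    move=> _ [v _ <-]; rewrite openE => z /= zv.
    by apply: filterS (near_coord finF z 0) => z' /= ->.
  apply/seteqP; split=> // z _.
  exists [set z' : Z | set_val z' 0%N = set_val z 0%N] => //.
  by exists (set_val z 0%N).
have [c [_ cE _ clim]] := cover_entropy_fin R Z0 (iterated_join_finite Z0 oa).
have ln2 : 0 < ln 2 :> R by rewrite ln_gt0// ltr1n.
have cpos : ln 2 / n%:R <= c.
  apply: clim => N; exists (n * N.+1)%N; first by nia.
  move=> j /subcover_enum[e eJ eZ].
  rewrite natrM mulrA divfK ?pnatr_eq0 -?lt0n// mulr_natr -lnXn// -natrX.
  pose s (b : N.+1.-tuple bool) : cantor_space := fun i => nth false b i.
  have /choice[h hP] : forall b, exists i : 'I_j, e i (coding pqF (s b)).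
    by move=> b; exact: eZ.
  have hinj : injective h.
    move=> b b' bb'; have := hP b; have := hP b'; rewrite bb'.
    have [A aA ->] := eJ (h b') => Ab' Ab.
    have ag : agree (n * N.+1).+1 (splice n p q (s b)) (splice n p q (s b')).
      move=> i im; have [v _ vA] := aA i im.
      have := Ab i im; have := Ab' i im; rewrite /= -vA /= !iter_shift addn0.
      by rewrite !coding_val => -> ->.
    apply/val_inj/(@eq_from_nth _ false); rewrite ?size_tuple// => k kN.
    apply: contrapT => bk; apply: npq => i im.
    have := ag (k * n + i)%N; rewrite !(spliceE _ _ pqF) /s //.
    have /[swap] /[apply] : (k * n + i < (n * N.+1).+1)%N by nia.
    by case: (nth _ b k) (nth _ b' k) bk => -[].
  have := leq_card _ hinj; rewrite card_tuple card_bool card_ord => le2j.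
  rewrite ler_ln ?posrE ?ltr0n ?expn_gt0 ?ler_nat//.
  by rewrite (leq_trans _ le2j)// expn_gt0.
rewrite /entropy; case: asboolP => [ZE|_ ent0].
  by have [z _] := Z0; have : [set: Z] z by []; rewrite ZE.
have : (cover_entropy R sigma alpha <= 0)%E.
  by rewrite -ent0; apply: ereal_sup_ubound; exists alpha.
rewrite cE lee_fin; apply/negP; rewrite -ltNge (lt_le_trans _ cpos)//.
by rewrite divr_gt0// ltr0n.
Qed.

End PathEntropy.

(** * Upper and lower limits of averages *)

Section UpperLowerLimits.
Context {R : realType}.
Implicit Types (u : nat -> R).

Lemma limn_einf_eq0 u : (forall n, 0 <= u n) ->
  (forall e, 0 < e -> forall N, exists2 n, (N <= n)%N & u n <= e) ->
  limn_einf (fun n => (u n)%:E) = 0%E.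
Proof.
move=> u0 ue; rewrite limn_einf_lim.
rewrite (_ : einfs _ = cst 0%E); first exact: lim_cst.
apply/funext => N; apply/eqP; rewrite eq_le; apply/andP; split.
  apply/lee_addgt0Pr => e e0; rewrite add0e; have [n Nn une] := ue e e0 N.
  apply: (@le_trans _ _ (u n)%:E); last by rewrite lee_fin.
  by apply: ereal_inf_lbound; exists n.
by apply: le_ereal_inf_tmp => _ [n _ <-]; rewrite lee_fin.
Qed.

Lemma limn_esup_gt0 u (e : R) : 0 < e ->
  (forall N, exists2 n, (N <= n)%N & e <= u n) ->
  (0 < limn_esup (fun n => (u n)%:E))%E.
Proof.
move=> e0 ue; rewrite limn_esup_lim; apply: (@lt_le_trans _ _ e%:E) => //.
apply: lime_ge; first exact: is_cvg_esups.
near=> N; have [n Nn une] := ue N.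
apply: (@le_trans _ _ (u n)%:E); first by rewrite lee_fin.
by apply: ereal_sup_ubound; exists n.
Unshelve. all: by end_near. Qed.

Lemma sum_le_middle u (D e : R) (a b c : nat) : 0 <= e -> (a <= b <= c)%N ->
  (forall i, u i <= D) -> (forall i, (a <= i < b)%N -> u i <= e) ->
  \sum_(i < c) u i <= D * a%:R + e * c%:R + D * (c - b)%:R.
Proof.
move=> e0 /andP[ab bc] uD ue.
rewrite -(big_mkord xpredT u) (@big_cat_nat _ _ _ a)//=; last exact: leq_trans ab bc.
rewrite (@big_cat_nat _ _ _ b a c)//= addrA.
have le_const v i j : (i <= j)%N -> (forall k, (i <= k < j)%N -> u k <= v) ->
    \sum_(i <= k < j) u k <= v * (j - i)%:R.
  move=> ij uv; rewrite mulr_natr -sumr_const_nat.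
  by rewrite big_nat [leRHS]big_nat; apply: ler_sum => k; exact: uv.
rewrite lerD//; last by apply: le_const => // k _.
rewrite lerD//; first by rewrite -{2}(subn0 a); apply: le_const => // k _.
rewrite (le_trans (le_const e _ _ _ _))// ler_wpM2l// ler_nat.
exact: leq_trans (leq_subr _ _) bc.
Qed.

(** One large term in each block of length [n]. *)
Lemma sum_ge_blocks u (e : R) (n a b r : nat) : 0 <= e -> (a <= b)%N -> (r < n)%N ->
  (forall i, 0 <= u i) -> (forall k, (a <= k < b)%N -> e <= u (k * n + r)%N) ->
  e * (b - a)%:R <= \sum_(i < b * n) u i.
Proof.
move=> e0 ab rn u0; elim: b ab => [|b IH].
  by rewrite leqn0 => /eqP -> _; rewrite mulr0 sumr_ge0.
rewrite leq_eqVlt => /orP[/eqP <- _|ab ue]; first by rewrite subnn mulr0 sumr_ge0.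
have {}IH : e * (b - a)%:R <= \sum_(i < b * n) u i.
  by apply: IH => // k /andP[ak kb]; apply: ue; rewrite ak ltnW.
rewrite subSn// -natr1 mulrDr mulr1 mulSnr -(big_mkord xpredT u).
rewrite (@big_cat_nat _ _ _ (b * n))//= ?leq_addr// big_mkord lerD//.
rewrite -{1}[(b * n)%N]add0n big_addn addKn big_mkord (bigD1 (Ordinal rn))//=.
rewrite [(r + _)%N]addnC; apply: le_trans (ue b _) _; first by rewrite -ltnS ab ltnSn.
by rewrite lerDl sumr_ge0.
Qed.

End UpperLowerLimits.

(** * Spreading a binary sequence over long intervals *)

(** The times are cut into the intervals [[a, a * a)] with [a = 2 ^ 2 ^ j], whose
    lengths dwarf all that precedes them; the level is the index [j]. *)
Definition tower_level k := trunc_log 2 (trunc_log 2 k).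

Lemma tower_levelE j k : (2 ^ 2 ^ j <= k < 2 ^ 2 ^ j * 2 ^ 2 ^ j)%N -> tower_level k = j.
Proof.
move=> /andP[jk kj]; apply: trunc_log_eq => //; apply/andP; split.
  exact: trunc_log_max.
rewrite -(ltn_exp2l _ _ (isT : (1 < 2)%N)) expnS mul2n -addnn expnD.
apply: leq_ltn_trans kj; apply: trunc_logP => //.
by rewrite (leq_trans _ jk)// expn_gt0.
Qed.

(** The interval of level [j] carries the bit [false] if [j] is odd, and the bit
    [c e] if [2 ^ e.+1] is the exact power of [2] in [j].  Thus each bit of [c],
    and also [false], fills infinitely many intervals. *)
Definition spread (c : cantor_space) : cantor_space :=
  fun k => if logn 2 (tower_level k) is e.+1 then c e else false.

Lemma ltn_tower j : (j < 2 ^ 2 ^ j)%N.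
Proof. by apply: (@leq_trans (2 ^ j)); [|apply: ltnW]; rewrite ltn_expl. Qed.

Lemma spread_agree N : exists2 a, (N < a)%N &
  forall c c' k, (a <= k < a * a)%N -> spread c k = spread c' k.
Proof.
exists (2 ^ 2 ^ (2 * N).+1)%N; first by rewrite (leq_trans _ (ltn_tower _))//; lia.
move=> c c' k /tower_levelE; rewrite /spread => ->.
by rewrite lognE dvdn2 /= mul2n odd_double.
Qed.

Lemma spread_copy e N : exists2 a, (N < a)%N &
  forall c k, (a <= k < a * a)%N -> spread c k = c e.
Proof.
exists (2 ^ 2 ^ (2 ^ e.+1 * (2 * N).+1))%N.
  have e0 : (0 < 2 ^ e.+1)%N by rewrite expn_gt0.
  by apply: leq_trans (ltn_tower _); nia.
move=> c k /tower_levelE; rewrite /spread => ->.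
rewrite lognM ?expn_gt0// pfactorK// [X in (_ + X)%N]lognE dvdn2 /= mul2n odd_double /=.
by rewrite addn0.
Qed.

(** * Scrambled sets and uncountability *)

(** Cantor's diagonal argument. *)
Lemma cantor_space_inj_nat (f : cantor_space -> nat) : ~ injective f.
Proof.
move=> finj; pose s : cantor_space :=
  fun n => ~~ `[< exists2 t : cantor_space, f t = n & t n >].
have : s (f s) = ~~ s (f s).
  rewrite {1}/s; congr (~~ _); apply/asboolP/idP => [[t /finj -> //]|ss].
  by exists s.
by case: (s _).
Qed.

Lemma uncountable_cantor_range (T : Type) (f : cantor_space -> T) :
  injective f -> ~ countable (range f).
Proof.
move=> finj /countable_injP[g ginj]; apply: (@cantor_space_inj_nat (g \o f)).
by move=> c c' /ginj cc'; apply/finj/cc'; apply/mem_set; [exists c|exists c'].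
Qed.

Lemma countable_path_set (R : realType) (X : metricType R) (F : set (X * X))
    (S : set (set_type (infinite_paths F))) :
  countable (infinite_paths F) -> countable S.
Proof.
move=> /countable_injP[f finj]; apply/countable_injP; exists (f \o set_val).
move=> z z' _ _ /finj zz'; apply/val_inj/zz'; exact: valP.
Qed.

Section Scrambling.
Context {R : realType} {X : metricType R} (F : set (X * X)).
Hypotheses (finF : finite_set F) (compactX : compact [set: X]).
Let Z : topologicalType := set_type (infinite_paths F).
Let sigma : Z -> Z := @shift_map R X F.
Variable d : Z -> Z -> R.
Hypothesis metric_d : compatible_metric d.

Lemma dist_refl x : d x x = 0.
Proof. by case: metric_d => d0 _ _ _; exact/d0. Qed.

Lemma dist_sym x y : d x y = d y x.
Proof. by case: metric_d. Qed.

Lemma dist_triangle y x z : d x z <= d x y + d y z.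
Proof. by case: metric_d. Qed.

Lemma dist_ge0 x y : 0 <= d x y.
Proof. by have := dist_triangle y x x; rewrite dist_refl (dist_sym y); lra. Qed.

Lemma nbhs_dist_ball x (e : R) : 0 < e -> nbhs x [set y | d x y < e].
Proof. by case: metric_d => _ _ _ nd e0; apply/nd; exists e. Qed.

Lemma dist_small (e : R) : 0 < e -> exists M, forall x y : Z,
  agree M (set_val x) (set_val y) -> d x y <= e.
Proof.
move=> e0; have e20 : 0 < e / 2 by rewrite divr_gt0.
have [z|M HM] := @cylinder_refines _ _ _ finF compactX
    (range (fun z : Z => [set y | d z y < e / 2])).
  by exists [set y | d z y < e / 2]; [exists z|exact: nbhs_dist_ball].
exists M => x y xy; have [_ [z _ <-] zx] := HM x.
have /= zxe : d z x < e / 2 by exact: zx.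
have /= zye : d z y < e / 2 by exact: zx.
by have := dist_triangle z x y; rewrite (dist_sym x z); lra.
Qed.

Lemma dist_bounded : exists D : R, 0 <= D /\ forall x y, d x y <= D.
Proof.
have [[z0 _]|nZ] := pselect (exists z : Z, True); last first.
  by exists 0; split=> // x; case: nZ; exists x.
pose P (i : nat) (z : Z) := d z0 z <= i%:R.
have /compact_near_coveringP/(_ nat \oo P) := compact_path_space finF compactX.
case=> [z _|N _ /(_ N (leqnn N)) H]; last first.
  exists (N%:R + N%:R); split; first by rewrite addr_ge0.
  move=> x y; rewrite (le_trans (dist_triangle z0 x y))// dist_sym lerD//; exact: H.
exists ([set y | d z y < 1], [set i | (Num.bound (d z0 z + 1) <= i)%N]).
  by split; [exact: nbhs_dist_ball|exists (Num.bound (d z0 z + 1))].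
move=> [y i] /= [zy bi]; rewrite /P (le_trans (dist_triangle z z0 y))//.
apply: (@le_trans _ _ (d z0 z + 1)); first by rewrite lerD2l ltW.
apply: (@le_trans _ _ (Num.bound (d z0 z + 1))%:R); last by rewrite ler_nat.
by apply/ltW/archi_boundP; rewrite addr_ge0 ?dist_ge0.
Qed.

(** Differing in the first coordinate is a clopen condition; compactness makes
    the resulting distance uniform. *)
Lemma dist_large : exists2 e : R, 0 < e &
  forall x y : Z, set_val x 0%N <> set_val y 0%N -> e <= d x y.
Proof.
pose P (i : nat) (z : Z) :=
  forall y : Z, set_val z 0%N <> set_val y 0%N -> i.+1%:R^-1 <= d z y.
have /compact_near_coveringP/(_ nat \oo P) := compact_path_space finF compactX.
case=> [z _|N _ /(_ N (leqnn N)) H]; last first.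
  by exists N.+1%:R^-1; [rewrite invr_gt0|move=> x y; exact: H].
case: metric_d => _ _ _ nd.
have [e e0 ze] := (nd z _).1 (near_coord finF z 0).
have e20 : 0 < e / 2 by rewrite divr_gt0.
exists ([set y | d z y < e / 2], [set i | (Num.bound (e / 2)^-1 <= i)%N]).
  by split; [exact: nbhs_dist_ball|exists (Num.bound (e / 2)^-1)].
move=> [x i] /= [zx bi] y xy.
have ex : set_val x 0%N = set_val z 0%N by apply: ze => /=; lra.
have zy : e <= d z y.
  by rewrite leNgt; apply/negP => /ze /= zy0; apply: xy; rewrite ex zy0.
apply: (@le_trans _ _ (e / 2)).
  rewrite invf_ple ?posrE//; apply: ltW.
  apply: (@lt_le_trans _ _ (Num.bound (e / 2)^-1)%:R).
    by apply: archi_boundP; rewrite invr_ge0 ltW.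
  by rewrite ler_nat ltnW.
by have := dist_triangle x z y; lra.
Qed.

Lemma LY_uncountable : Li_Yorke_chaotic d sigma -> ~ countable (infinite_paths F).
Proof. by move=> [S ncS _] /(@countable_path_set _ _ _ S). Qed.

Lemma DC2_uncountable : has_DC2_scrambled_Cantor_set d sigma ->
  ~ countable (infinite_paths F).
Proof.
move=> [C [h [g [_ _ hg _]]] _] /(@countable_path_set _ _ _ (range (set_val \o h))).
by apply: uncountable_cantor_range => c c' /val_inj /(can_inj hg).
Qed.

Lemma uncountable_double_loop : ~ countable (infinite_paths F) -> has_double_loop F.
Proof. by move=> nc; apply: contrapT => /(countable_walks finF). Qed.

Variables (n : nat) (p q : nat -> X).
Hypothesis pqF : double_loop F n p q.

Definition scrambled_point (c : cantor_space) : Z := coding pqF (spread c).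

Let n0 : (0 < n)%N. Proof. by case: pqF. Qed.

Lemma splitting_index : exists2 r, (r < n)%N & p r <> q r.
Proof.
have [_ _ pq [pn qn] npq] := pqF; apply: contrapT => /forall2NP H.
apply: npq => i; rewrite ltnS leq_eqVlt => /orP[/eqP ->|im]; first by rewrite -pn -qn.
by have [//|/contrapT] := H i.
Qed.

Lemma coding_agree_dist (s s' : cantor_space) a b M t e :
  (forall x y : Z, agree M (set_val x) (set_val y) -> d x y <= e) ->
  (forall k, (a <= k < b)%N -> s k = s' k) ->
  (a * n <= t)%N -> (t + M <= b * n)%N ->
  orbit_dist d sigma (coding pqF s) (coding pqF s') t <= e.
Proof.
move=> dM ss' at_ tb; apply: dM => i iM; rewrite !iter_shift !coding_val /splice ss'//.
by rewrite leq_divRL// ltn_divLR//; lia.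
Qed.

Lemma coding_differ_dist (s s' : cantor_space) k r e :
  (forall x y : Z, set_val x 0%N <> set_val y 0%N -> e <= d x y) ->
  (r < n)%N -> p r <> q r -> s k <> s' k ->
  e <= orbit_dist d sigma (coding pqF s) (coding pqF s') (k * n + r)%N.
Proof.
move=> de rn pqr ss'; apply: de.
rewrite !iter_shift addn0 !(codingE pqF _ _ (ltnW rn)).
case: (s k) (s' k) ss' => -[] //= _; exact: nesym.
Qed.

Lemma spread_scrambled c c' : c <> c' -> forall N, exists2 a, (N < a)%N &
  forall k, (a <= k < a * a)%N -> spread c k <> spread c' k.
Proof.
move=> cc' N; have [i ci] : exists i, c i <> c' i.
  by apply: contrapT => /forallNP H; apply/cc'/funext => i; exact: contrapT.
have [a Na ca] := spread_copy i N; exists a => // k ak.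
by rewrite !ca.
Qed.

(** The orbits are close at the start of an interval where the spread sequences
    agree, and apart once in each block of an interval where they differ. *)
Lemma scrambled_point_LY c c' : c <> c' ->
  LY_scrambled d sigma (scrambled_point c) (scrambled_point c').
Proof.
move=> cc'; split.
  apply: limn_einf_eq0 => [t|e e0 N]; first exact: dist_ge0.
  have [M dM] := dist_small e0; have [a Na ca] := spread_agree (N + M).+2.
  exists (a * n)%N; first by nia.
  by apply: (coding_agree_dist dM (ca c c')); nia.
have [e e0 de] := dist_large; have [r rn pqr] := splitting_index.
apply: (limn_esup_gt0 e0) => N; have [a Na ca] := spread_scrambled cc' N.+2.
exists (a * n + r)%N; first by nia.
by apply: (coding_differ_dist de) => //; apply: ca; nia.
Qed.

(** The averages are taken at the end [a * a * n] of an interval.  Where the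
    spread sequences agree, only the first [a * n] and the last [M] distances may
    exceed [e / 2], which is negligible for large [a].  Where they differ, each
    of the [a * a - a >= a * a / 2] blocks contributes a distance at least
    [e]. *)
Lemma scrambled_point_DC2 c c' : c <> c' ->
  DC2_scrambled d sigma (scrambled_point c) (scrambled_point c').
Proof.
move=> cc'.
have u0 t : 0 <= orbit_dist d sigma (scrambled_point c) (scrambled_point c') t.
  exact: dist_ge0.
split.
  apply: limn_einf_eq0 => [t|e e0 N].
    by rewrite /mean_orbit_dist mulr_ge0// sumr_ge0.
  have e20 : 0 < e / 2 by rewrite divr_gt0.
  have [M dM] := dist_small e20; have [D [D0 dD]] := dist_bounded.
  pose B := Num.bound (D * M.+1%:R / (e / 2)).
  have HB : D * M.+1%:R <= (e / 2) * B%:R.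
    rewrite -ler_pdivrMl// mulrC; apply/ltW/archi_boundP.
    by rewrite divr_ge0 ?mulr_ge0// ltW.
  have [a Na ca] := spread_agree (N + M + B).+2.
  have aM : (a * n + M <= a * a * n)%N.
    have : (a * n * 1 + M <= a * n * a)%N by nia.
    by rewrite muln1 mulnAC.
  have Baan : (B * (a * n) <= a * a * n)%N by rewrite -mulnA leq_mul2r; lia.
  exists (a * a * n)%N; first by nia.
  rewrite /mean_orbit_dist ler_pdivrMl ?ltr0n; last by nia.
  have := @sum_le_middle R (orbit_dist d sigma (scrambled_point c) (scrambled_point c'))
    D (e / 2) (a * n) (a * a * n - M) (a * a * n) (ltW e20).
  move=> /(_ _ (fun t => dD _ _) _)/le_trans; apply; first by lia.
    by move=> t /andP[at_ ta]; apply: (coding_agree_dist dM (ca c c')) => //; lia.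
  rewrite (_ : (a * a * n - (a * a * n - M) = M)%N); last by lia.
  have : D * (a * n)%:R + D * M%:R <= e / 2 * (a * a * n)%:R.
    rewrite -mulrDr -natrD.
    apply: (@le_trans _ _ (D * M.+1%:R * (a * n)%:R)).
      rewrite -mulrA -natrM ler_wpM2l// ler_nat mulSn leq_add2l.
      by rewrite leq_pmulr// muln_gt0 n0 andbT; lia.
    apply: (@le_trans _ _ (e / 2 * B%:R * (a * n)%:R)); first by rewrite ler_wpM2r.
    by rewrite -mulrA -natrM ler_wpM2l ?ler_nat// ltW.
  lra.
have [e e0 de] := dist_large; have [r rn pqr] := splitting_index.
have en0 : 0 < e / (2 * n)%:R by rewrite divr_gt0// ltr0n muln_gt0.
apply: (limn_esup_gt0 en0) => N; have [a Na ca] := spread_scrambled cc' N.+2.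
exists (a * a * n)%N; first by nia.
rewrite /mean_orbit_dist ler_pdivlMl ?ltr0n; last by nia.
have sum_ge : e * (a * a - a)%:R <= \sum_(t < a * a * n)
    orbit_dist d sigma (scrambled_point c) (scrambled_point c') t.
  apply: (sum_ge_blocks (ltW e0) _ rn u0); first by nia.
  by move=> k ak; apply: (coding_differ_dist de) => //; exact: ca.
apply: le_trans sum_ge.
rewrite mulrCA; apply: ler_wpM2l; first exact: ltW.
rewrite ler_pdivrMr ?ltr0n ?muln_gt0// -natrM ler_nat mulnA leq_mul2r.
have : (a * 2 <= a * a)%N by rewrite leq_mul2l; lia.
lia.
Qed.

(** Each bit of [c] can be read off from a single coordinate, which gives both the
    injectivity of the embedding and the continuity of its inverse. *)
Lemma scrambled_point_bit c r i : (r < n)%N -> p r <> q r ->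
  exists k, forall c',
    set_val (scrambled_point c') k = set_val (scrambled_point c) k -> c' i = c i.
Proof.
move=> rn pqr; have [a a1 ca] := spread_copy i 1.
exists (a * n + r)%N => c'.
rewrite !(codingE pqF _ _ (ltnW rn)) !ca; try nia.
by case: (c i) (c' i) => -[] // E; case: pqr.
Qed.

Lemma scrambled_point_inj : injective scrambled_point.
Proof.
move=> c c' cc'; apply/funext => i; have [r rn pqr] := splitting_index.
by have [k] := scrambled_point_bit c' i rn pqr; apply; rewrite cc'.
Qed.

Lemma scrambled_point_continuous : continuous scrambled_point.
Proof.
move=> c; apply: (@continuous_comp _ _ _ spread (coding pqF)); last first.
  exact: coding_continuous.
move: c; apply: (@continuous_locally_constant bool) => c k; rewrite /spread.
case: (logn _ _) => [|e]; first by near=> c'.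
exact: near_bit.
Unshelve. all: by end_near. Qed.

Lemma double_loop_LY : Li_Yorke_chaotic d sigma.
Proof.
exists (range scrambled_point).
  exact: uncountable_cantor_range scrambled_point_inj.
move=> _ _ [c _ <-] [c' _ <-] cc'; apply: scrambled_point_LY => E.
by apply: cc'; rewrite E.
Qed.

Lemma double_loop_DC2 : has_DC2_scrambled_Cantor_set d sigma.
Proof.
exists (range scrambled_point); last first.
  move=> _ _ [c _ <-] [c' _ <-] cc'; apply: scrambled_point_DC2 => E.
  by apply: cc'; rewrite E.
have im c : scrambled_point c \in range scrambled_point by apply/mem_set; exists c.
pose h c : set_type (range scrambled_point) :=
  exist (fun z => z \in range scrambled_point) _ (im c).
have /choice[g gP] : forall z : set_type (range scrambled_point),
    exists c, scrambled_point c = set_val z.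
  by move=> z; have [c _ cz] := set_mem (valP z); exists c.
have gh : cancel g h by move=> z; apply/val_inj; rewrite /= gP.
have hg : cancel h g by move=> c; apply: scrambled_point_inj; rewrite gP.
exists h, g; split=> //.
  by apply: continuous_comp_initial; exact: scrambled_point_continuous.
apply: (@continuous_locally_constant bool) => z i; have [r rn pqr] := splitting_index.
have [k kP] := scrambled_point_bit (g z) i rn pqr.
have : \forall z' \near z, set_val (set_val z' : Z) k = set_val (set_val z : Z) k.
  exact: (@initial_continuous _ _ set_val z _ (near_coord finF (set_val z) k)).
by apply: filterS => z' zz'; apply: kP; rewrite !gP.
Qed.

End Scrambling.

Theorem theorem4p2 (R : realType) (X : metricType R)
    (compactX : compact [set: X]) (F : set (X * X)) (finF : finite_set F)
    (d : set_type (infinite_paths F) -> set_type (infinite_paths F) -> R)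
    (metric_d : compatible_metric d) :
  [<->
            CR_turbulent F;
            exists2 n : nat, (0 < n)%N &
              separated_turbulent (iter n (@shift_map R X F));
            exists2 n : nat, (0 < n)%N &
              exists x y : set_type (finite_paths F n),
                [/\ x <> y, path_coord ord0 x = path_coord ord0 y,
                    path_coord ord0 y = path_coord ord_max x &
                    path_coord ord_max x = path_coord ord_max y];
            entropy R (@shift_map R X F) <> 0%E;
            ~ countable (infinite_paths F);
            Li_Yorke_chaotic d (@shift_map R X F);
            has_DC2_scrambled_Cantor_set d (@shift_map R X F)].
Proof.
pose entropy_dl := @entropy_double_loop R X F finF compactX.
pose dl_DC2 := double_loop_DC2 finF compactX metric_d.
split=> [/(CR_turbulent_double_loop finF) [n [p [q pqF]]]|].
  by exists n; [case: pqF|exact: double_loop_separated_turbulent pqF].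
split=> [[n n0 /(separated_turbulent_double_loop finF compactX n0)]|].
  by move/double_loop_pathsP.
split=> [/double_loop_pathsP[n [p [q pqF]]]|]; first exact: double_loop_entropy pqF.
split=> [/entropy_dl[n [p [q pqF]]]|].
  exact: DC2_uncountable (dl_DC2 _ _ _ pqF).
split=> [/(uncountable_double_loop finF)[n [p [q pqF]]]|].
  exact: double_loop_LY pqF.
split=> [/LY_uncountable/(uncountable_double_loop finF)[n [p [q pqF]]]|].
  exact: dl_DC2 pqF.
by move=> /DC2_uncountable/(uncountable_double_loop finF)/double_loop_CR_turbulent.
Qed.
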